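(* Let $n,k,\ell$ be integers with $1\le k\le n$ and $\ell\ge 0$. There exists a (randomized) algorithm that solves the $\ell$-bounded error partition learning problem on $V=[n]$ for hidden partitions into $k$ clusters and makes at most $$ (\ell+1)\left( \frac{n(k+1)}{2} - k \right) + \ell $$ queries in expectation (over the algorithm's internal randomness), both when $k$ is known to the algorithm and when it is not.
   Context: Given a partition $\mathcal{C}$ of a finite set $V$, the same-cluster oracle $\alpha_{\mathcal{C}}$ takes a pair $\{u,v\}$ of distinct elements of $V$ and returns $1$ if $u,v$ lie in the same cluster of $\mathcal{C}$ and $-1$ otherwise. An $\ell$-faulty same-cluster oracle may return an incorrect answer on at most $\ell$ of the queries made over the whole run; errors may be chosen adversarially and are not persistent (repeating a query may give different answers). The $\ell$-bounded error partition learning problem is: given $V$ and access to an $\ell$-faulty same-cluster oracle for an unknown partition $\mathcal{C}$ of $V$ into $k$ nonempty clusters, always exactly recover $\mathcal{C}$. The expectation bound holds for every hidden partition and every admissible oracle behavior. *)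

(* Defs.v *)
From mathcomp Require Import all_boot all_order all_algebra.

Set Implicit Arguments.
Unset Strict Implicit.
Unset Printing Implicit Defensive.

Import GRing.Theory Num.Theory.
Local Open Scope ring_scope.

(* [partition] already forces every cluster to be nonempty. *)
Definition clustering (n k : nat) (C : {set {set 'I_n}}) : Prop :=
  partition C [set: 'I_n] /\ #|C| = k.

(* A query is an unordered pair of distinct elements. *)
Definition query (n : nat) : Type := {e : {set 'I_n} | #|e| == 2%N}.

(* Oracle answers are booleans: [true] stands for 1, [false] for -1. *)
Definition same_cluster (n : nat) (C : {set {set 'I_n}}) (q : query n) : bool :=
  [exists B in C, val q \subset B].

(* Chronological list of the queries made so far and the answers received. *)
Definition history (n : nat) : Type := seq (query n * bool).

(* An answer may depend on the whole past interaction, so the oracle can be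
   adaptive, and a repeated query need not receive the same answer. *)
Definition oracle (n : nat) : Type := history n -> query n -> bool.

Inductive det_alg (n : nat) : Type :=
| Output of {set {set 'I_n}}
| Ask of query n & (bool -> det_alg n).

Fixpoint run_from (n : nat) (O : oracle n) (h : history n) (t : det_alg n) :
    {set {set 'I_n}} * history n :=
  match t with
  | Output P => (P, h)
  | Ask q next => let a := O h q in run_from O (rcons h (q, a)) (next a)
  end.

Definition output (n : nat) (O : oracle n) (t : det_alg n) : {set {set 'I_n}} :=
  (run_from O [::] t).1.

Definition transcript (n : nat) (O : oracle n) (t : det_alg n) : history n :=
  (run_from O [::] t).2.

Definition num_queries (n : nat) (O : oracle n) (t : det_alg n) : nat :=
  size (transcript O t).

Definition num_errors (n : nat) (C : {set {set 'I_n}}) (O : oracle n)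
    (t : det_alg n) : nat :=
  count (fun qa : query n * bool => qa.2 != same_cluster C qa.1)
    (transcript O t).

(* A randomized algorithm draws a seed once and for all and then runs the
   deterministic algorithm attached to that seed; the oracle does not see
   the seed. *)
Record rand_alg (R : realFieldType) (n : nat) : Type := RandAlg {
  seed : finType;
  prob : seed -> R;
  prob_ge0 : forall s, 0 <= prob s;
  prob_sum1 : \sum_s prob s = 1;
  det_of : seed -> det_alg n
}.

Definition expected_queries (R : realFieldType) (n : nat) (A : rand_alg R n)
    (O : oracle n) : R :=
  \sum_(s : seed A) prob s * (num_queries O (det_of s))%:R.

Definition faulty_for (R : realFieldType) (n l : nat) (A : rand_alg R n)
    (C : {set {set 'I_n}}) (O : oracle n) : Prop :=
  forall s : seed A, (num_errors C O (det_of s) <= l)%N.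

Definition solves (R : realFieldType) (n k l : nat) (A : rand_alg R n) : Prop :=
  forall C : {set {set 'I_n}}, clustering k C ->
  forall (O : oracle n) (s : seed A),
    (num_errors C O (det_of s) <= l)%N -> output O (det_of s) = C.

Definition expected_queries_le (R : realFieldType) (n k l : nat)
    (A : rand_alg R n) (b : R) : Prop :=
  forall C : {set {set 'I_n}}, clustering k C ->
  forall O : oracle n, faulty_for l A C O -> expected_queries A O <= b.

Definition query_bound (R : realFieldType) (n k l : nat) : R :=
  (l%:R + 1) * (n%:R * (k%:R + 1) / 2 - k%:R) + l%:R.

(* Main.v *)
(* Without errors: process the elements in a uniformly random order; the first
   remaining element is compared with all other remaining ones, which reveals
   its cluster, and the cluster is removed. The ordered pair (u, v) is queried
   exactly when u is the first element of cl(u) :|: cl(v), so with probability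
   1 / #|cl(u) :|: cl(v)|; summing, with 1 / (a + b) <= (1 / a + 1 / b) / 4 for
   distinct clusters of sizes a and b, gives at most n (k + 1) / 2 - k.
   With at most l errors: repeat each query until some answer has occurred l + 1
   times. That answer is correct, and the query costs l + 1 plus the number of
   errors spent on it, so that all errors together cost at most l. *)
Require Import Defs.
From mathcomp Require Import all_boot all_order all_algebra.
From mathcomp Require Import fingroup perm zify ring lra.

Set Implicit Arguments.
Unset Strict Implicit.
Unset Printing Implicit Defensive.

Import Order.TTheory GRing.Theory Num.Theory.

Lemma leq_size_filter (T : Type) (p : pred T) (s : seq T) m :
  size s <= m -> size (filter p s) <= m.
Proof. by rewrite size_filter; apply: leq_trans (count_size _ _). Qed.

Definition first_in (T : finType) (S : {set T}) (s : seq T) (u : T) : bool :=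
  ohead [seq w <- s | w \in S] == Some u.

Lemma first_in_cons (T : finType) (S : {set T}) x s u :
  first_in S (x :: s) u = if x \in S then x == u else first_in S s u.
Proof. by rewrite /first_in /=; case: ifP. Qed.

Section RandomOrder.

Variable T : finType.
Implicit Types (S : {set T}) (s : {perm T}) (u w : T).

Lemma card_perm_gt0 : 0 < #|{perm T}|.
Proof. by apply/card_gt0P; exists 1%g. Qed.

Lemma codom_perm_uniq s : uniq (codom s).
Proof. by rewrite map_inj_uniq ?enum_uniq //; apply: perm_inj. Qed.

Lemma mem_codom_perm s u : u \in codom s.
Proof. by rewrite injF_onto //; apply: perm_inj. Qed.

Lemma first_in_map S s (r : seq T) u : (forall w, (s w \in S) = (w \in S)) ->
  first_in S (map s r) (s u) = first_in S r u.
Proof.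
move=> sS; rewrite /first_in filter_map (eq_filter sS).
case: [seq w <- r | w \in S] => //= w r'.
by rewrite !(inj_eq Some_inj) (inj_eq perm_inj).
Qed.

Lemma sum_first_in S (r : seq T) : has (mem S) r ->
  \sum_(u in S) first_in S r u = 1.
Proof.
elim: r => //= w r IH; have [wS _|wS /IH <-] := boolP (w \in S).
  rewrite (bigD1 w) //= first_in_cons wS eqxx big1 // => u /andP[_ uw].
  by rewrite first_in_cons wS eq_sym (negPf uw).
by apply: eq_bigr => u _; rewrite first_in_cons (negPf wS).
Qed.

(* Exchanging two elements of [S] in all orders shows that each element of [S]
   comes first equally often. *)
Lemma sum_perm_first_in S u : u \in S ->
  #|S| * \sum_(s : {perm T}) first_in S (codom s) u = #|{perm T}|.
Proof.
move=> uS; pose N w := \sum_(s : {perm T}) first_in S (codom s) w.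
have N_const w : w \in S -> N w = N u.
  move=> wS; rewrite /N (reindex_inj (mulIg (tperm u w))) /=.
  apply: eq_bigr => s _.
  have -> : codom (s * tperm u w)%g = map (tperm u w) (codom s).
    by rewrite -map_comp; apply: eq_map => i; rewrite permM.
  rewrite -[in RHS](@first_in_map S (tperm u w)) ?tpermL // => i.
  by case: tpermP => [->|->|//]; rewrite uS wS.
rewrite -/(N u) -sum_nat_const -(eq_bigr _ N_const) exchange_big /= -sum1_card.
apply: eq_bigr => s _; apply: sum_first_in; apply/hasP; exists u => //.
exact: mem_codom_perm.
Qed.

Lemma big_codom_perm (F : T -> nat) (P : pred T) s :
  \sum_(u <- codom s | P u) F u = \sum_(u | P u) F u.
Proof. by rewrite big_image_cond [RHS](reindex_inj (@perm_inj _ s)). Qed.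

End RandomOrder.

Definition fiber (T : finType) (L : eqType) (c : T -> L) (u : T) : {set T} :=
  [set w | c u == c w].

Lemma first_in_fibers_cons (T : finType) (L : eqType) (c : T -> L)
    (x u v : T) r (p := fun w => c x != c w) : x \notin r -> u \in r ->
  first_in (fiber c u :|: fiber c v) (x :: r) u =
  [&& p u, p v & first_in (fiber c u :|: fiber c v) (filter p r) u].
Proof.
move=> xr ur; have xu : (x == u) = false by apply: contraNF xr => /eqP->.
rewrite first_in_cons !inE ![_ == c x]eq_sym -if_neg negb_or -/(p u) -/(p v) xu.
have [pu|//] := boolP (p u); have [pv|//] := boolP (p v) => /=.
rewrite /first_in -filter_predI; congr (ohead _ == _); apply: eq_filter => w.
rewrite /= !inE /p; have [<-|_] := eqVneq (c u) (c w).
  by rewrite -/(p u) pu.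
by have [<-|//] := eqVneq (c v) (c w); rewrite -/(p v) pv.
Qed.

Lemma preim_partition_split (T : finType) (L : eqType) (c : T -> L)
    (D : {set T}) x : x \in D ->
  preim_partition c D =
  [set y in D | c x == c y] |: preim_partition c [set y in D | c x != c y].
Proof.
move=> xD; have fiberE z : c x != c z ->
    [set y in [set y in D | c x != c y] | c z == c y] =
    [set y in D | c z == c y].
  move=> xz; apply/setP=> y; rewrite !inE.
  by case: (c z =P c y) => [<-|]; rewrite ?andbF // xz !andbT.
apply/setP=> B; rewrite in_setU1; apply/imsetP/predU1P => [[z zD ->]|[->|]].
- have [xz|xz] := eqVneq (c x) (c z); first by left; rewrite xz.
  by right; apply/imsetP; exists z; rewrite ?fiberE // inE zD.
- by exists x.
- by case/imsetP=> z /[!inE] /andP[zD xz] ->; exists z; rewrite ?fiberE.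
Qed.

Local Open Scope ring_scope.

Lemma sum_inv_card (R : realFieldType) (T : finType) (A : {pred T}) :
  (0 < #|A|)%N -> \sum_(x in A) #|A|%:R^-1 = 1 :> R.
Proof.
by move=> A_gt0; rewrite sumr_const -[LHS]mulr_natr mulVf // pnatr_eq0 -lt0n.
Qed.

Lemma invfD_le (R : realFieldType) (a b : R) : 0 < a -> 0 < b ->
  (a + b)^-1 <= (a^-1 + b^-1) / 4.
Proof.
move=> a_gt0 b_gt0; rewrite -subr_ge0.
have -> : (a^-1 + b^-1) / 4 - (a + b)^-1 = (a - b) ^+ 2 / (4 * a * b * (a + b)).
  by field; rewrite !gt_eqF // addr_gt0.
by rewrite divr_ge0 ?sqr_ge0 // !mulr_ge0 ?addr_ge0 ?ltW.
Qed.

Lemma mean_first_in (R : realFieldType) (T : finType) (S : {set T}) u :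
  u \in S ->
  #|{perm T}|%:R^-1 * (\sum_(s : {perm T}) first_in S (codom s) u)%:R =
  #|S|%:R^-1 :> R.
Proof.
move=> uS; have S_neq0 : #|S|%:R != 0 :> R.
  by rewrite pnatr_eq0 cards_eq0; apply/set0Pn; exists u.
have perm_neq0 : #|{perm T}|%:R != 0 :> R.
  by rewrite pnatr_eq0 -lt0n card_perm_gt0.
rewrite mulrC; apply: (canLR (mulfK perm_neq0)).
by rewrite -(sum_perm_first_in uS) natrM mulKf.
Qed.

Section FiberSums.

Variables (R : realFieldType) (T : finType) (L : eqType) (c : T -> L).

Lemma eq_fiber u v : (fiber c u == fiber c v) = (c u == c v).
Proof.
apply/eqP/eqP=> [/setP/(_ v)|uv]; first by rewrite !inE eqxx => /eqP.
by apply/setP=> w; rewrite !inE uv.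
Qed.

Lemma card_fiber_gt0 u : (0 < #|fiber c u|)%N.
Proof. by apply/card_gt0P; exists u; rewrite inE. Qed.

Lemma card_fiberU u v : c u != c v ->
  #|fiber c u :|: fiber c v| = (#|fiber c u| + #|fiber c v|)%N.
Proof.
move=> uv; rewrite cardsU (_ : _ :&: _ = set0) ?cards0 ?subn0 //.
by apply/setP=> w; rewrite !inE; case: eqP => //= <-; rewrite eq_sym (negPf uv).
Qed.

Lemma sum_inv_card_fiber :
  \sum_u #|fiber c u|%:R^-1 = #|preim_partition c [set: T]|%:R :> R.
Proof.
have -> : preim_partition c [set: T] = [set fiber c u | u in predT].
  by apply/setP=> B; apply/imsetP/imsetP=> -[u _ ->]; exists u => //;
    apply/setP=> w; rewrite !inE.
rewrite (partition_big_imset (fiber c)) -sumr_const; apply: eq_bigr => B.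
case/imsetP=> w _ ->.
under eq_bigr => u /eqP-> do [].
rewrite -[RHS](sum_inv_card R (card_fiber_gt0 w)); apply: eq_bigl => u.
by rewrite eq_fiber inE eq_sym.
Qed.

Lemma inv_card_fiberU_le u v :
  #|fiber c u :|: fiber c v|%:R^-1 <=
  (#|fiber c u|%:R^-1 + #|fiber c v|%:R^-1) / 4 +
    (if v \in fiber c u then #|fiber c u|%:R^-1 / 2 else 0) :> R.
Proof.
have gt0 w : 0 < #|fiber c w|%:R :> R by rewrite ltr0n card_fiber_gt0.
rewrite inE; have [uv|uv] := eqVneq (c u) (c v).
  have /eqP-> : fiber c u == fiber c v by rewrite eq_fiber uv.
  by rewrite setUid; lra.
by rewrite card_fiberU // natrD addr0 invfD_le.
Qed.

Lemma sum_inv_card_fiberU_le (k := #|preim_partition c [set: T]|) :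
  \sum_u \sum_(v | v != u) #|fiber c u :|: fiber c v|%:R^-1 <=
  #|T|%:R * (k%:R + 1) / 2 - k%:R :> R.
Proof.
pose a u : R := #|fiber c u|%:R^-1.
have sum_a : \sum_u a u = k%:R := sum_inv_card_fiber.
have rowE u : \sum_(v | v != u) #|fiber c u :|: fiber c v|%:R^-1 =
    \sum_v #|fiber c u :|: fiber c v|%:R^-1 - a u.
  by rewrite [in RHS](bigD1 u) //= setUid addrC addrK.
have row_le u : \sum_v #|fiber c u :|: fiber c v|%:R^-1 <=
    #|T|%:R * a u / 4 + k%:R / 4 + 1 / 2.
  apply: le_trans (ler_sum _ (fun v _ => inv_card_fiberU_le u v)) _.
  rewrite big_split -big_mkcond /= -!mulr_suml sum_inv_card ?card_fiber_gt0 //.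
  by rewrite big_split /= sumr_const sum_a -[a u *+ _]mulr_natl; lra.
under eq_bigr => u _ do rewrite rowE.
rewrite sumrB sum_a lerD2r; apply: le_trans (ler_sum _ (fun u _ => row_le u)) _.
rewrite !big_split /= !sumr_const -!mulr_suml -mulr_sumr sum_a.
by rewrite -(mulr_natl (k%:R / 4)) -(mulr_natl (1 / 2)); lra.
Qed.

End FiberSums.

Local Close Scope ring_scope.

Section Runs.

Variables (n : nat) (truth : query n -> bool).
Implicit Types (O : oracle n) (t : det_alg n) (h : history n) (q : query n).

Definition errors h : nat := count (fun qa => qa.2 != truth qa.1) h.

Definition truthful : oracle n := fun=> truth.

Definition oracle_after O (qa : query n * bool) : oracle n :=
  fun h => O (qa :: h).

Lemma run_from_cat O h1 h2 t :
  run_from O (h1 ++ h2) t =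
  let r := run_from (fun h => O (h1 ++ h)) h2 t in (r.1, h1 ++ r.2).
Proof. by elim: t h2 => [//|q next IH] h2 /=; rewrite rcons_cat. Qed.

Lemma output_Ask O q next (a := O [::] q) :
  output O (Ask q next) = output (oracle_after O (q, a)) (next a).
Proof. by rewrite /output /= (run_from_cat O [:: _] [::]). Qed.

Lemma transcript_Ask O q next (a := O [::] q) :
  transcript O (Ask q next) =
  (q, a) :: transcript (oracle_after O (q, a)) (next a).
Proof. by rewrite /transcript /= (run_from_cat O [:: _] [::]). Qed.

Lemma num_queries_Ask O q next (a := O [::] q) :
  num_queries O (Ask q next) =
  (num_queries (oracle_after O (q, a)) (next a)).+1.
Proof. by rewrite /num_queries transcript_Ask. Qed.

Lemma errors_Ask O q next (a := O [::] q) :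
  errors (transcript O (Ask q next)) =
  (a != truth q) + errors (transcript (oracle_after O (q, a)) (next a)).
Proof. by rewrite transcript_Ask. Qed.

Lemma output_truthful_Ask q next :
  output truthful (Ask q next) = output truthful (next (truth q)).
Proof. exact: output_Ask. Qed.

Lemma num_queries_truthful_Ask q next :
  num_queries truthful (Ask q next) =
  (num_queries truthful (next (truth q))).+1.
Proof. exact: num_queries_Ask. Qed.

Lemma errors_truthful t : errors (transcript truthful t) = 0.
Proof. by elim: t => [//|q next IH]; rewrite errors_Ask eqxx IH. Qed.

Lemma run_errorless O t : errors (transcript O t) = 0 ->
  output O t = output truthful t /\ num_queries O t = num_queries truthful t.
Proof.
elim: t O => [//|q next IH] O.
rewrite errors_Ask output_Ask num_queries_Ask.
rewrite output_truthful_Ask num_queries_truthful_Ask => /eqP.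
rewrite addn_eq0 eqb0 negbK => /andP[/eqP-> /eqP no_errors].
by have [-> ->] := IH _ _ no_errors.
Qed.

End Runs.

Section Voting.

Variables (n : nat) (truth : query n -> bool).
Implicit Types (O : oracle n) (t : det_alg n) (q : query n).

(* [missing a] is one less than the number of answers [a] that still have to be
   received before [a] is accepted. The fuel [m] suffices as soon as it is at
   least [missing true + missing false]. *)
Fixpoint vote q (next : bool -> det_alg n) (m : nat) (missing : bool -> nat) :
    det_alg n :=
  Ask q (fun a =>
    if m is m'.+1 then
      if missing a is 0 then next a
      else vote q next m' (fun b => missing b - (b == a))
    else next a).

Fixpoint amplify (l : nat) t : det_alg n :=
  match t with
  | Output P => Output P
  | Ask q next => vote q (fun a => amplify l (next a)) l.*2 (fun=> l)
  end.

Lemma run_vote O q next m missing (t := vote q next m missing) :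
  missing true + missing false <= m ->
  exists e O' a,
    [/\ output O t = output O' (next a),
        errors truth (transcript O t) =
          e + errors truth (transcript O' (next a))
      & if a == truth q
        then num_queries O t = (missing a).+1 + e + num_queries O' (next a)
        else missing a < e].
Proof.
rewrite {}/t; elim: m O missing => [|m IH] O missing le_m;
  rewrite output_Ask errors_Ask num_queries_Ask; set a := O [::] q.
  exists (a != truth q), (oracle_after O (q, a)), a; split=> //.
  by case: (a) le_m; case: eqP; lia.
case missing_a : (missing a) => [|k].
  exists (a != truth q), (oracle_after O (q, a)), a; split=> //.
  by rewrite missing_a; case: eqP.
have [|e [O' [b [-> -> accepted]]]] :=
  IH (oracle_after O (q, a)) (fun b => missing b - (b == a)).
  by case: (a) missing_a => /=; lia.
exists ((a != truth q) + e), O', b; split; rewrite ?addnA //.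
case: eqP accepted => [-> ->|/eqP b_wrong].
  by rewrite [truth q == a]eq_sym; case: eqP => [<-|_] /=; lia.
by have [<-|_] := eqVneq b a; rewrite ?b_wrong /=; lia.
Qed.

Lemma run_amplify l O t (e := errors truth (transcript O (amplify l t))) :
  e <= l ->
  output O (amplify l t) = output (truthful truth) t /\
  num_queries O (amplify l t) = l.+1 * num_queries (truthful truth) t + e.
Proof.
rewrite {}/e; elim: t O => [P|q next IH] O; first by rewrite /num_queries muln0.
rewrite output_truthful_Ask num_queries_truthful_Ask mulnS.
have [|e [O' [a [/= -> ->]]]] :=
  @run_vote O q (fun a => amplify l (next a)) l.*2 (fun=> l).
  by rewrite addnn.
case: eqP => [-> -> le_l|_]; last by lia.
have [|-> ->] := IH (truth q) O'; first by lia.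
by split=> //; lia.
Qed.

End Voting.

Section PivotLearning.

Variable n : nat.

(* [insub] fails exactly when [u = v], and then no query is needed. *)
Definition ask_same (u v : 'I_n) (next : bool -> det_alg n) : det_alg n :=
  if insub [set u; v] is Some q then Ask q next else next true.

Fixpoint compare_all (x : 'I_n) (r : seq 'I_n) (next : bitseq -> det_alg n) :
    det_alg n :=
  if r is v :: r' then
    ask_same x v (fun b => compare_all x r' (fun bs => next (b :: bs)))
  else next [::].

(* [m] is fuel: [size s] is enough. *)
Fixpoint pivot_learn (m : nat) (s : seq 'I_n) (P : {set {set 'I_n}}) :
    det_alg n :=
  match m, s with
  | m'.+1, x :: r =>
    compare_all x r (fun bs =>
      pivot_learn m' (mask (map negb bs) r) ([set y in x :: mask bs r] |: P))
  | _, _ => Output P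
  end.

End PivotLearning.

Definition compares_labels n (L : eqType) (c : 'I_n -> L)
    (truth : query n -> bool) : Prop :=
  forall q u v, val q = [set u; v] -> truth q = (c u == c v).

Section PivotRuns.

Variables (n : nat) (L : eqType) (c : 'I_n -> L) (truth : query n -> bool).
Hypothesis truthP : compares_labels c truth.

Lemma output_ask_same u v next :
  output (truthful truth) (ask_same u v next) =
  output (truthful truth) (next (c u == c v)).
Proof.
rewrite /ask_same; case: insubP => /= [q _ /truthP <-|].
  exact: output_truthful_Ask.
by rewrite cards2; have [->|//] := eqVneq u v; rewrite eqxx.
Qed.

Lemma num_queries_ask_same u v next :
  num_queries (truthful truth) (ask_same u v next) =
  (u != v) + num_queries (truthful truth) (next (c u == c v)).
Proof.
rewrite /ask_same; case: insubP => /= [q uv /truthP <-|].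
  by rewrite num_queries_truthful_Ask; move: uv; rewrite cards2; case: (u != v).
by rewrite cards2; have [->|//] := eqVneq u v; rewrite eqxx.
Qed.

Lemma output_compare_all x r next :
  output (truthful truth) (compare_all x r next) =
  output (truthful truth) (next [seq c x == c v | v <- r]).
Proof. by elim: r next => //= v r IH next; rewrite output_ask_same IH. Qed.

Lemma num_queries_compare_all x r next : x \notin r ->
  num_queries (truthful truth) (compare_all x r next) =
  size r + num_queries (truthful truth) (next [seq c x == c v | v <- r]).
Proof.
elim: r next => //= v r IH next; rewrite inE negb_or => /andP[xv xr].
by rewrite num_queries_ask_same IH // xv.
Qed.

Lemma output_pivot_learn m s P : size s <= m ->
  output (truthful truth) (pivot_learn m s P) =
  preim_partition c [set y in s] :|: P.
Proof.
have preim0 : preim_partition c [set y in [::]] = set0.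
  by apply/setP=> B; rewrite inE; apply/imsetP=> -[z]; rewrite inE.
elim: m s P => [|m IH] [|x r] P //=; rewrite ?preim0 ?set0U // => le_m.
rewrite (@preim_partition_split _ _ c _ x) ?inE ?eqxx //.
rewrite output_compare_all -map_comp -!filter_mask IH ?leq_size_filter //.
rewrite setUCA -setUA; congr (_ |: (preim_partition c _ :|: P)); apply/setP=> y;
  rewrite !inE mem_filter /= andbC.
- by case: (eqVneq y x) => [->|]; rewrite ?eqxx.
- by case: (eqVneq y x) => [->|]; rewrite ?eqxx ?andbF.
Qed.

Lemma num_queries_pivot_learn m s P : uniq s -> size s <= m ->
  num_queries (truthful truth) (pivot_learn m s P) =
  \sum_(u <- s) \sum_(v <- s | v != u) first_in (fiber c u :|: fiber c v) s u.
Proof.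
elim: m s P => [|m IH] [|x r] P //=; rewrite ?big_nil //.
move=> /andP[xr ur] le_m.
rewrite num_queries_compare_all // -map_comp -!filter_mask.
rewrite IH ?filter_uniq ?leq_size_filter // big_cons; congr (_ + _).
  rewrite big_cons eqxx -sum1_size [RHS]big_mkcond; apply: eq_big_seq => v vr.
  have -> : v != x by apply: contraNneq xr => <-.
  by rewrite first_in_cons !inE !eqxx.
rewrite big_filter big_mkcond; apply: eq_big_seq => u ur'.
under [RHS]eq_bigr => v _ do rewrite first_in_fibers_cons //.
rewrite [LHS]/=; have [_|_] /= := boolP (c x != c u); last by rewrite big1.
rewrite big_filter_cond big_mkcond [RHS]big_mkcond big_cons eqxx /= if_same.
by apply: eq_bigr => v _; case: (c x == c v) (v != u) => [] [].
Qed.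

End PivotRuns.

Section Robustness.

Local Open Scope ring_scope.

Variables (R : realFieldType) (n : nat).
Implicit Types (A : rand_alg R n) (O : oracle n).

Definition robust l A : rand_alg R n :=
  RandAlg (@prob_ge0 _ _ A) (prob_sum1 A) (fun s => amplify l (det_of s)).

Lemma solves_robust k l A : solves k 0 A -> solves k l (robust l A).
Proof.
move=> solves_A C Ck O s /run_amplify[-> _]; apply: solves_A => //.
by rewrite leqn0; apply/eqP; apply: errors_truthful.
Qed.

Lemma expected_queries_le_robust k l A b :
  expected_queries_le k 0 A b ->
  expected_queries_le k l (robust l A) ((l%:R + 1) * b + l%:R).
Proof.
move=> le_b C Ck O faulty; pose O' := truthful (same_cluster C).
have faulty0 : faulty_for 0 A C O'.
  by move=> s; rewrite leqn0; apply/eqP; apply: errors_truthful.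
apply: (@le_trans _ _ ((l%:R + 1) * expected_queries A O' + l%:R)); last first.
  by rewrite lerD2r ler_wpM2l ?natr1 ?ler0n //; exact: (le_b C Ck O' faulty0).
have -> : (l%:R + 1) * expected_queries A O' + l%:R =
    \sum_(s : seed A)
      prob s * ((l%:R + 1) * (num_queries O' (det_of s))%:R + l%:R).
  under [RHS]eq_bigr do rewrite mulrDr mulrCA.
  by rewrite big_split -mulr_sumr -mulr_suml prob_sum1 mul1r.
apply: ler_sum => s _; rewrite ler_wpM2l ?prob_ge0 //.
have [_ ->] := run_amplify (faulty s).
by rewrite natr1 -natrM -natrD ler_nat leq_add2l; apply: faulty.
Qed.

End Robustness.

Lemma same_cluster_compares_pblock n (C : {set {set 'I_n}}) :
  partition C [set: 'I_n] -> compares_labels (pblock C) (@same_cluster n C).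
Proof.
move=> partC q u v qE; have tI := partition_trivIset partC.
have covC w : w \in cover C by rewrite (cover_partition partC) inE.
rewrite /same_cluster qE; apply/exists_inP/eqP => [[B BC]|uv].
  by rewrite subUset !sub1set => /andP[uB vB]; rewrite !(def_pblock tI BC).
exists (pblock C u); first exact: pblock_mem.
by rewrite subUset !sub1set {2}uv !mem_pblock !covC.
Qed.

Section RandomPivot.

Local Open Scope ring_scope.

Variables (R : realFieldType) (n : nat).

Lemma uniform_ge0 (S : finType) (s : S) : 0 <= #|S|%:R^-1 :> R.
Proof. by rewrite invr_ge0 ler0n. Qed.

Definition uniform_alg (S : finType) (S_gt0 : (0 < #|S|)%N)
    (A : S -> det_alg n) : rand_alg R n :=
  RandAlg (@uniform_ge0 S) (sum_inv_card R S_gt0) A.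

Definition random_pivot : rand_alg R n :=
  uniform_alg (card_perm_gt0 'I_n) (fun s => pivot_learn n (codom s) set0).

Lemma expected_queries_random_pivot (L : eqType) (c : 'I_n -> L) truth :
  compares_labels c truth ->
  expected_queries random_pivot (truthful truth) =
  \sum_u \sum_(v | v != u) #|fiber c u :|: fiber c v|%:R^-1.
Proof.
move=> truthP; rewrite /expected_queries /= -mulr_sumr -natr_sum.
have size_s (s : 'S_n) : size (codom s) = n by rewrite size_codom card_ord.
under eq_bigr => s _.
  rewrite (num_queries_pivot_learn truthP) ?codom_perm_uniq ?size_s //.
  rewrite big_codom_perm.
  under eq_bigr do rewrite big_codom_perm.
  over.
rewrite exchange_big natr_sum mulr_sumr; apply: eq_bigr => u _.
rewrite exchange_big natr_sum mulr_sumr; apply: eq_bigr => v _.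
by rewrite mean_first_in // !inE eqxx.
Qed.

Lemma solves_random_pivot k : solves k 0 random_pivot.
Proof.
move=> C [partC _] O s; rewrite leqn0 => /eqP/run_errorless[-> _].
rewrite (output_pivot_learn (same_cluster_compares_pblock partC))
  ?size_codom ?card_ord // setU0.
have -> : [set y in codom s] = [set: 'I_n].
  by apply/setP=> y; rewrite !inE mem_codom_perm.
exact: preim_partition_pblock.
Qed.

Lemma expected_queries_le_random_pivot k :
  expected_queries_le k 0 random_pivot (n%:R * (k%:R + 1) / 2 - k%:R).
Proof.
move=> C [partC <-] O faulty.
have -> : expected_queries random_pivot O =
    expected_queries random_pivot (truthful (same_cluster C)).
  apply: eq_bigr => s _; congr (_ * _%:R).
  by have /[!leqn0] /eqP/run_errorless[_ ->] := faulty s.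
rewrite (expected_queries_random_pivot (same_cluster_compares_pblock partC)).
have := sum_inv_card_fiberU_le R (pblock C).
by rewrite preim_partition_pblock // card_ord.
Qed.

End RandomPivot.

Theorem theorem3 (R : realFieldType) (n l : nat) :
  (* k known: the algorithm may depend on k *)
  (forall k : nat, 1 <= k <= n ->
     exists A : rand_alg R n,
       solves k l A /\ expected_queries_le k l A (query_bound R n k l))
  /\
  (* k unknown: a single algorithm serves every k *)
  (exists A : rand_alg R n,
     forall k : nat, 1 <= k <= n ->
       solves k l A /\ expected_queries_le k l A (query_bound R n k l)).
Proof.
pose A := robust l (random_pivot R n).
have A_spec k :
    solves k l A /\ expected_queries_le k l A (query_bound R n k l).
  split; first exact/solves_robust/solves_random_pivot.
  exact/expected_queries_le_robust/expected_queries_le_random_pivot.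
by split=> [k _|]; exists A.
Qed.
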